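(* Let $R$ be a ring that is not von Neumann regular. Suppose that $R$ is two-sided coherent and that every pure-injective left $R$-module is injective or pi-indigent. Then either $R$ is two-sided semihereditary or $R$ is a right IF-ring.
   Context: Rings are associative with identity. A module $M$ is called $N$-subinjective (for $N$ a module on the same side) if for every module $K$ containing $N$ as a submodule, every homomorphism $N\to M$ extends to a homomorphism $K\to M$. The subinjectivity domain of $M$ is $\underline{\mathfrak{In}}^{-1}(M)=\{N : M \text{ is } N\text{-subinjective}\}$. A module $N$ is absolutely pure (fp-injective) if every short exact sequence $0\to N\to B\to C\to 0$ is pure exact. A pure-injective module $M$ is called pi-indigent if $\underline{\mathfrak{In}}^{-1}(M)$ is exactly the class of absolutely pure modules (on the same side as $M$). A ring $R$ is a right IF-ring if every absolutely pure right $R$-module is flat. *)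

(* Defs.v *)
From HB Require Import structures.
From mathcomp Require Import all_boot all_order all_algebra ring_quotient.
From mathcomp Require Import boolp.
From mathcomp.multinomials Require Import freeg.

Set Implicit Arguments.
Unset Strict Implicit.
Unset Printing Implicit Defensive.

Import GRing.Theory.
Local Open Scope ring_scope.
Local Open Scope quotient_scope.

(* Left R-modules are [lmodType R]; right R-modules are [lmodType R^c], the
   product m.a of a right module being [(a : R^c) *: m].  Submodules are given
   by injective linear maps.  A [pzRingType] is an associative ring with
   identity, the zero ring being allowed. *)

Definition von_neumann_regular (R : pzRingType) : Prop :=
  forall a : R, exists x : R, a * x * a = a.

Definition short_exact (A B C : zmodType) (f : A -> B) (g : B -> C) : Prop :=
  [/\ injective f,
      forall b : B, g b = 0 <-> exists a : A, f a = b
    & forall c : C, exists b : B, g b = c].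

Section TensorProduct.

Variables (R : pzRingType) (M : lmodType R^c) (N : lmodType R).

Local Notation gen m n := (<< (m, n) >> : {freeg (M * N)%type}).

Inductive tensor_rel : {freeg (M * N)%type} -> Prop :=
| tensor_rel0 : tensor_rel 0
| tensor_relB x y : tensor_rel x -> tensor_rel y -> tensor_rel (x - y)
| tensor_relDl m m' n : tensor_rel (gen (m + m') n - (gen m n + gen m' n))
| tensor_relDr m n n' : tensor_rel (gen m (n + n') - (gen m n + gen m n'))
| tensor_relZ m (a : R) n :
    tensor_rel (gen ((a : R^c) *: m) n - gen m (a *: n)).

Definition tensor_relations : {pred {freeg (M * N)%type}} :=
  fun x => `[< tensor_rel x >].

Lemma tensor_relations_closed : zmod_closed tensor_relations.
Proof.
split; first exact/asboolP/tensor_rel0.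
by move=> x y /asboolP hx /asboolP hy; apply/asboolP/tensor_relB.
Qed.

HB.instance Definition _ :=
  GRing.isZmodClosed.Build _ tensor_relations tensor_relations_closed.

Definition tensor : zmodType := Quotient.quot tensor_relations.

Definition tens (m : M) (n : N) : tensor := \pi_tensor (gen m n).

Lemma pi_tensorB : {morph \pi_tensor : x y / x - y >-> x - y}.
Proof.
move=> x y; apply: etrans (Quotient.pi_add tensor_relations x (- y)) _.
by rewrite [in LHS](Quotient.pi_opp tensor_relations y).
Qed.

Lemma pi_tensorD : {morph \pi_tensor : x y / x + y >-> x + y}.
Proof. exact: Quotient.pi_add. Qed.

Lemma tens_eq (x y : {freeg (M * N)%type}) :
  tensor_rel (x - y) -> \pi_tensor x = \pi_tensor y.
Proof. by move=> h; apply/eqP; rewrite -Quotient.idealrBE; apply/asboolP. Qed.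

Lemma tensDl m m' n : tens (m + m') n = tens m n + tens m' n.
Proof. by rewrite /tens -pi_tensorD; apply/tens_eq/tensor_relDl. Qed.

Lemma tensDr m n n' : tens m (n + n') = tens m n + tens m n'.
Proof. by rewrite /tens -pi_tensorD; apply/tens_eq/tensor_relDr. Qed.

Lemma tensZ m (a : R) n : tens ((a : R^c) *: m) n = tens m (a *: n).
Proof. exact/tens_eq/tensor_relZ. Qed.

Variable G : zmodType.

Definition balanced (b : M -> N -> G) : Prop :=
  [/\ forall m m' n, b (m + m') n = b m n + b m' n,
      forall m n n', b m (n + n') = b m n + b m n'
    & forall m (a : R) n, b ((a : R^c) *: m) n = b m (a *: n)].

(* The additive map M (x) N -> G induced by [b]; the value on a class is
   computed on a representative, hence only meaningful if [b] is balanced. *)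
Definition tensor_lift (b : M -> N -> G) (t : tensor) : G :=
  fglift (fun p : M * N => b p.1 p.2 : zmodule G) (repr t).

Lemma tensor_lift_pi b (x : {freeg (M * N)%type}) : balanced b ->
  tensor_lift b (\pi_tensor x) = fglift (fun p : M * N => b p.1 p.2 : zmodule G) x.
Proof.
move=> [bDl bDr bZ]; rewrite /tensor_lift; set L := fglift _.
have LB : {morph L : u v / u - v} := @lift_is_additive _ _ _ _.
have L0 : L 0 = 0 by rewrite -(subrr 0) LB subrr.
have LD u v : L (u + v) = L u + L v.
  by rewrite -[v in LHS]opprK -[- v]sub0r !LB L0 sub0r opprK.
have LU m n : L (<< (m, n) >>)%R = b m n by rewrite /L liftU scale1r.
have L_rel y : tensor_rel y -> L y = 0.
  elim=> [//|u v _ hu _ hv|m m' n|m n n'|m a n].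
  - by rewrite LB hu hv subrr.
  - by rewrite LB LD !LU bDl subrr.
  - by rewrite LB LD !LU bDr subrr.
  - by rewrite LB !LU bZ subrr.
apply/eqP; rewrite -subr_eq0 -LB; apply/eqP/L_rel/asboolP.
have /eqP := reprK (\pi_tensor x : tensor).
by rewrite -Quotient.idealrBE.
Qed.

Lemma tensor_liftE b m n : balanced b -> tensor_lift b (tens m n) = b m n.
Proof. by move=> hb; rewrite tensor_lift_pi // liftU scale1r. Qed.

Lemma tensor_lift_additive b : balanced b ->
  {morph tensor_lift b : x y / x - y}.
Proof.
move=> hb x y; rewrite -[x]reprK -[y]reprK.
by rewrite -pi_tensorB !tensor_lift_pi // lift_is_additive.
Qed.

End TensorProduct.

(* f (x) g, with its intended meaning when f and g are linear. *)
Definition tensor_map (R : pzRingType) (M M' : lmodType R^c) (N N' : lmodType R)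
    (f : M -> M') (g : N -> N') : tensor M N -> tensor M' N' :=
  tensor_lift (fun m n => tens (f m) (g n)).

Lemma tensor_mapE (R : pzRingType) (M M' : lmodType R^c) (N N' : lmodType R)
    (f : {linear M -> M'}) (g : {linear N -> N'}) m n :
  tensor_map f g (tens m n) = tens (f m) (g n).
Proof.
rewrite /tensor_map tensor_liftE //; split=> *.
- by rewrite linearD tensDl.
- by rewrite linearD tensDr.
- by rewrite !linearZ tensZ.
Qed.

Definition left_pure_exact (R : pzRingType) (A B C : lmodType R)
    (f : {linear A -> B}) (g : {linear B -> C}) : Prop :=
  short_exact f g /\
  forall X : lmodType R^c,
    short_exact (tensor_map (@idfun X) f) (tensor_map (@idfun X) g).

Definition right_pure_exact (R : pzRingType) (A B C : lmodType R^c)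
    (f : {linear A -> B}) (g : {linear B -> C}) : Prop :=
  short_exact f g /\
  forall X : lmodType R,
    short_exact (tensor_map f (@idfun X)) (tensor_map g (@idfun X)).

Definition left_absolutely_pure (R : pzRingType) (N : lmodType R) : Prop :=
  forall (B C : lmodType R) (f : {linear N -> B}) (g : {linear B -> C}),
    short_exact f g -> left_pure_exact f g.

Definition right_absolutely_pure (R : pzRingType) (N : lmodType R^c) : Prop :=
  forall (B C : lmodType R^c) (f : {linear N -> B}) (g : {linear B -> C}),
    short_exact f g -> right_pure_exact f g.

Definition right_flat (R : pzRingType) (F : lmodType R^c) : Prop :=
  forall (A B : lmodType R) (f : {linear A -> B}),
    injective f -> injective (tensor_map (@idfun F) f).

Definition right_IF_ring (R : pzRingType) : Prop :=
  forall N : lmodType R^c, right_absolutely_pure N -> right_flat N.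

Definition injective_module (R : pzRingType) (M : lmodType R) : Prop :=
  forall (A B : lmodType R) (i : {linear A -> B}), injective i ->
  forall f : {linear A -> M}, exists g : {linear B -> M}, forall a, g (i a) = f a.

Definition pure_injective (R : pzRingType) (M : lmodType R) : Prop :=
  forall (A B C : lmodType R) (i : {linear A -> B}) (p : {linear B -> C}),
    left_pure_exact i p ->
  forall f : {linear A -> M}, exists g : {linear B -> M}, forall a, g (i a) = f a.

Definition projective_module (R : pzRingType) (P : lmodType R) : Prop :=
  forall (A B : lmodType R) (p : {linear A -> B}),
    (forall b, exists a, p a = b) ->
  forall f : {linear P -> B}, exists g : {linear P -> A}, forall x, p (g x) = f x.

(* M is N-subinjective *)
Definition subinjective (R : pzRingType) (M N : lmodType R) : Prop :=
  forall (K : lmodType R) (i : {linear N -> K}), injective i ->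
  forall f : {linear N -> M}, exists g : {linear K -> M}, forall x, g (i x) = f x.

Definition subinjectivity_domain (R : pzRingType) (M : lmodType R) :
    lmodType R -> Prop :=
  fun N => subinjective M N.

Definition pi_indigent (R : pzRingType) (M : lmodType R) : Prop :=
  pure_injective M /\
  forall N : lmodType R, subinjectivity_domain M N <-> left_absolutely_pure N.

Definition finitely_generated (R : pzRingType) (M : lmodType R) : Prop :=
  exists (n : nat) (x : 'I_n -> M),
    forall m, exists r : 'I_n -> R, m = \sum_i r i *: x i.

Definition finitely_presented (R : pzRingType) (M : lmodType R) : Prop :=
  exists (n k : nat) (q : {linear 'rV[R]_k -> 'rV[R]_n})
         (p : {linear 'rV[R]_n -> M}),
    (forall v, p v = 0 <-> exists u, q u = v) /\ (forall m, exists v, p v = m).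

(* A left ideal is a left module I with an injective linear map I -> R. *)
Definition left_coherent (R : pzRingType) : Prop :=
  forall (I : lmodType R) (i : {linear I -> R^o}),
    injective i -> finitely_generated I -> finitely_presented I.

Definition left_semihereditary (R : pzRingType) : Prop :=
  forall (I : lmodType R) (i : {linear I -> R^o}),
    injective i -> finitely_generated I -> projective_module I.

(* The left ideals of R^c are the right ideals of R. *)
Definition right_coherent (R : pzRingType) : Prop := left_coherent R^c.

Definition right_semihereditary (R : pzRingType) : Prop :=
  left_semihereditary R^c.

(* Main.v *)
From HB Require Import structures.
Require Import Defs.
From mathcomp Require Import all_boot all_algebra ring_quotient.
From mathcomp Require Import boolp classical_sets.
From mathcomp.multinomials Require Import freeg.

(** Write F^+ for the left module Hom_Z(F, Q/Z) of a right module F.  It is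
always pure-injective, because Hom(A, F^+) = (F (x) A)^+, and if it is
injective then F is flat.

The dividing line is the condition [flat_ideals R]: if a b = 0, for a row a
and a column b over R, then some square matrix C has a C = 0 and C b = b.
This says that every finitely generated one-sided ideal is flat.  Replacing C
by 1 - C shows that the condition is left-right symmetric.

Suppose that it holds.  By coherence the relations between generators b of a
left ideal I are generated by the rows of a matrix Q.  From Q b = 0 one gets
Q C = 0 and C b = b, and then r b |-> r C splits the projection of a free
module onto I, so I is projective.  By symmetry R is semihereditary on both
sides ([flat_ideals_semihereditary], [flat_ideals_op]).

Suppose that it fails for a and b, and let F be the right ideal generated by
a.  If F^+ were injective, then a and b would satisfy the condition
([flat_ideals_witness]); so F^+ is not injective, hence is pi-indigent.  But
F^+ is a quotient of the injective module R^+, so that a map R -> F^+ lifts to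
R^+ and extends to every module containing R: thus F^+ is R-subinjective
([lchar_subinjective_ring]), and R is absolutely pure as a left module.

It remains to see that, over a left coherent ring which is absolutely pure as
a left module, an absolutely pure right module N is flat
([right_absolutely_pure_flat]).  In an absolutely pure module every consistent
finite linear system is solvable ([left_absolutely_pure_solvable] and its right
version).  Given a relation n s = 0 between a row over N and a column over R,
let the rows of C generate the row relations of s.  Solving systems in R shows
that any v with C v = 0 is a multiple s x, so n v = 0; hence the system
n = m C is consistent, and is solvable in N
([right_absolutely_pure_relations]).  This equational form of flatness makes
N^+ satisfy Baer's criterion, so N is flat.

Baer's criterion is proved once over an arbitrary ring: over Z it yields the
extension and separation properties of characters, and over R the injectivity
of N^+. *)

Set Implicit Arguments.
Unset Strict Implicit.
Unset Printing Implicit Defensive.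

Import GRing.Theory Num.Theory.
Local Open Scope ring_scope.
Local Open Scope quotient_scope.

(** * Submodules and quotient modules *)

Record submodule (R : pzRingType) (V : lmodType R) := Submodule {
  in_submodule :> V -> Prop;
  submodule0 : in_submodule 0;
  submoduleP : forall a u v,
    in_submodule u -> in_submodule v -> in_submodule (a *: u + v) }.

Section SubmoduleTheory.
Variables (R : pzRingType) (V : lmodType R) (S : submodule V).

Lemma submoduleD u v : S u -> S v -> S (u + v).
Proof. by move=> Su Sv; rewrite -[u]scale1r; apply: submoduleP. Qed.

Lemma submoduleZ a u : S u -> S (a *: u).
Proof.
move=> Su; rewrite -[_ *: _]addr0; apply: submoduleP => //.
exact: submodule0.
Qed.

Lemma submoduleN u : S u -> S (- u).
Proof. by move=> Su; rewrite -scaleN1r; apply: submoduleZ. Qed.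

Lemma submoduleB u v : S u -> S v -> S (u - v).
Proof. by move=> Su Sv; apply: submoduleD => //; apply: submoduleN. Qed.

Definition submodule_pred : {pred V} := fun v => `[< S v >].

Lemma submodule_pred_closed : zmod_closed submodule_pred.
Proof.
split=> [|u v]; first exact/asboolP/submodule0.
by move=> /asboolP Su /asboolP Sv; apply/asboolP/submoduleB.
Qed.

HB.instance Definition _ :=
  GRing.isZmodClosed.Build _ submodule_pred submodule_pred_closed.

Definition quotient_module := Quotient.quot submodule_pred.

HB.instance Definition _ := GRing.Zmodule.on quotient_module.

Definition quotient_proj (v : V) : quotient_module := \pi_quotient_module v.

Lemma quotient_proj_eq u v : quotient_proj u = quotient_proj v <-> S (u - v).
Proof.
split=> [/eqP|h]; first by rewrite -Quotient.idealrBE => /asboolP.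
by apply/eqP; rewrite -Quotient.idealrBE; apply/asboolP.
Qed.

Lemma quotient_reprP v : S (repr (quotient_proj v) - v).
Proof. by apply/quotient_proj_eq; rewrite /quotient_proj reprK. Qed.

Lemma quotient_projD u v :
  quotient_proj (u + v) = quotient_proj u + quotient_proj v.
Proof. exact: (Quotient.pi_add submodule_pred). Qed.

Lemma quotient_proj_surj (x : quotient_module) : exists v, quotient_proj v = x.
Proof. by exists (repr x); rewrite /quotient_proj reprK. Qed.

Definition quotient_scale a (x : quotient_module) : quotient_module :=
  quotient_proj (a *: repr x).

Lemma quotient_projZ a v :
  quotient_proj (a *: v) = quotient_scale a (quotient_proj v).
Proof.
apply/quotient_proj_eq; rewrite -scalerBr -opprB scalerN.
exact/submoduleN/submoduleZ/quotient_reprP.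
Qed.

Fact quotient_scaleA a b x :
  quotient_scale a (quotient_scale b x) = quotient_scale (a * b) x.
Proof.
by have [v <-] := quotient_proj_surj x; rewrite -!quotient_projZ scalerA.
Qed.

Fact quotient_scale1 x : quotient_scale 1 x = x.
Proof.
by have [v <-] := quotient_proj_surj x; rewrite -!quotient_projZ scale1r.
Qed.

Fact quotient_scaleDr a : {morph quotient_scale a : x y / x + y}.
Proof.
move=> x y; have [v <-] := quotient_proj_surj x.
have [w <-] := quotient_proj_surj y.
by rewrite -quotient_projD -!quotient_projZ -quotient_projD scalerDr.
Qed.

Fact quotient_scaleDl x : {morph quotient_scale^~ x : a b / a + b}.
Proof.
move=> a b; have [v <-] := quotient_proj_surj x.
by rewrite -!quotient_projZ -quotient_projD scalerDl.
Qed.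

HB.instance Definition _ := GRing.Zmodule_isLmodule.Build R quotient_module
  quotient_scaleA quotient_scale1 quotient_scaleDr quotient_scaleDl.

Fact quotient_proj_linear : linear quotient_proj.
Proof. by move=> a u v; rewrite quotient_projD quotient_projZ. Qed.

HB.instance Definition _ :=
  GRing.isLinear.Build R V quotient_module _ quotient_proj quotient_proj_linear.

Lemma quotient_proj0 v : quotient_proj v = 0 <-> S v.
Proof. by rewrite -(linear0 quotient_proj) quotient_proj_eq subr0. Qed.

End SubmoduleTheory.

(** A map out of a quotient, in the form in which all quotients and submodules
below are used: the quotient is any surjection. *)
Lemma linear_factor (R : pzRingType) (V U W : lmodType R)
    (p : {linear V -> U}) (f : {linear V -> W}) :
  (forall u, exists v, p v = u) -> (forall v, p v = 0 -> f v = 0) ->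
  exists g : {linear U -> W}, forall v, g (p v) = f v.
Proof.
move=> /choice[s sK] pf0; pose g0 u := f (s u).
have g0E v : g0 (p v) = f v.
  by apply/eqP; rewrite -subr_eq0 -linearB pf0 // linearB sK subrr.
have g0L : linear g0.
  by move=> a u v; rewrite -[u]sK -[v]sK -linearP !g0E linearP.
by exists (HB.pack g0 (GRing.isLinear.Build R U W _ g0 g0L) : {linear U -> W}).
Qed.

Section KernelImage.
Variables (R : pzRingType) (V W : lmodType R) (f : {linear V -> W}).

Definition ker_submodule : submodule V.
Proof.
exists (fun v => f v = 0); first exact: linear0.
by move=> a u v hu hv; rewrite linearP hu hv scaler0 addr0.
Defined.

Definition img_submodule : submodule W.
Proof.
exists (fun w => exists v, f v = w); first by exists 0; rewrite linear0.
by move=> a _ _ [u <-] [v <-]; exists (a *: u + v); rewrite linearP.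
Defined.

Lemma quotient_kernel_embeds :
  exists2 g : {linear quotient_module ker_submodule -> W}, injective g &
    forall v, g (quotient_proj ker_submodule v) = f v.
Proof.
have [||g gE] := @linear_factor _ _ _ _ (quotient_proj ker_submodule) f.
- exact: quotient_proj_surj.
- by move=> v /quotient_proj0.
exists g => // x y; have [v <-] := quotient_proj_surj x.
have [w <-] := quotient_proj_surj y; rewrite !gE => e.
by apply/quotient_proj_eq => /=; rewrite linearB e subrr.
Qed.

End KernelImage.

(** * Baer's criterion *)

(** Partial linear maps are handled through their graphs, so that no type for
their domains is needed. *)
Definition functional_graph (R : pzRingType) (V D : lmodType R)
  (G : submodule (V * D)%type) := forall d, G (0, d) -> d = 0.

(** A functional graph in R x D is a linear map from a left ideal to D; the
condition asks that it be the right multiplication by an element of D. *)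
Definition baer_module (R : pzRingType) (D : lmodType R) :=
  forall J : submodule (R^o * D)%type, functional_graph J ->
  exists d : D, forall (s : R) (e : D), J (s, e) -> e = s *: d.

Section Baer.
Variables (R : pzRingType) (V D : lmodType R).
Hypothesis baerD : baer_module D.

(** Extending a partial map M to the element v amounts to choosing its value on
v compatibly with M on the ideal of the s with s v in the domain of M; that is
what the hypothesis on D provides. *)
Lemma baer_graph_extend (M : submodule (V * D)%type) v : functional_graph M ->
  exists2 M' : submodule (V * D)%type, functional_graph M' &
    (forall p, M p -> M' p) /\ exists d, M' (v, d).
Proof.
move=> fM.
have J0 : M ((0 : R) *: v, 0 : D) by rewrite scale0r; apply: submodule0.
have JP (a : R) (p q : R^o * D) : M ((p.1 : R) *: v, p.2) ->
    M ((q.1 : R) *: v, q.2) -> M (((a *: p + q).1 : R) *: v, (a *: p + q).2).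
  move=> hp hq; have := submoduleP a hp hq; congr (in_submodule _ (_, _)).
  by rewrite /= scalerDl scalerA.
have [|d dP] := @baerD (Submodule J0 JP).
  by move=> e /=; rewrite scale0r; apply: fM.
pose P (p : V * D) := exists s : R, M (p.1 - s *: v, p.2 - s *: d).
have P0 : P 0 by exists 0; rewrite !scale0r !subr0; apply: submodule0.
have PP a p q : P p -> P q -> P (a *: p + q).
  move=> [s hs] [t ht]; exists (a * s + t).
  have := submoduleP a hs ht; congr (in_submodule _ (_, _)) => /=;
    by rewrite scalerDl scalerBr scalerA opprD addrACA.
exists (Submodule P0 PP).
  move=> e [s /=]; rewrite sub0r => hs0.
  have hs : M ((- s) *: v, e - s *: d) by rewrite scaleNr.
  have := dP (- s) (e - s *: d) hs; rewrite scaleNr => h.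
  by apply: (addIr (- (s *: d))); rewrite h add0r.
split=> [[p e] hp|].
  by exists 0; rewrite /= !scale0r !subr0.
by exists d, 1; rewrite /= !scale1r !subrr; apply: submodule0.
Qed.

(** Zorn's lemma applied to the functional graphs that contain G. *)
Lemma baer_graph (G : submodule (V * D)%type) : functional_graph G ->
  exists h : {linear V -> D}, forall v d, G (v, d) -> h v = d.
Proof.
move=> fG.
pose T : set (set (V * D)) := fun X =>
  exists2 S : submodule (V * D)%type, X = in_submodule S &
    functional_graph S /\ (forall p, G p -> S p).
(* The union with G makes the empty chain harmless: its upper bound is G. *)
pose T' : set (set (V * D)) := fun X => T (X `|` in_submodule G)%classic.
have [F FT totF|X [TX maxX]] := @Zorn_bigcup _ T'.
  set U := (X in T' X).
  pose UG : set (V * D) := (U `|` in_submodule G)%classic.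
  have inU X : F X -> forall p, X p -> UG p.
    by move=> FX p Xp; left; exists X.
  (* The conditions on UG involve at most two of its elements at a time, and
     these lie in a single member of the chain, joined with G. *)
  have covU p q : UG p -> UG q -> exists S : submodule (V * D)%type,
      [/\ functional_graph S, S p, S q & forall r, S r -> UG r].
    have one X : F X -> exists S : submodule (V * D)%type,
        [/\ functional_graph S, forall r, X r -> S r, forall r, G r -> S r
          & forall r, S r -> UG r].
      move=> FX; have [S SE [fS GS]] := FT _ FX; exists S; split=> // r.
        by move=> Xr; rewrite -SE; left.
      by rewrite -SE => -[Xr|]; [apply: inU FX _ Xr | right].
    case=> [[X FX Xp]|Gp] [[Y FY Yq]|Gq].
    - have [XY|YX] := totF _ _ FX FY.
        by have [S [fS h1 h2 h3]] := one Y FY; exists S; split; auto.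
      by have [S [fS h1 h2 h3]] := one X FX; exists S; split; auto.
    - by have [S [fS h1 h2 h3]] := one X FX; exists S; split; auto.
    - by have [S [fS h1 h2 h3]] := one Y FY; exists S; split; auto.
    - by exists G; split=> // r Gr; right.
  have U0 : UG 0 by right; apply: submodule0.
  have UP a p q : UG p -> UG q -> UG (a *: p + q).
    move=> hp hq; have [S [_ Sp Sq SU]] := covU _ _ hp hq.
    exact/SU/submoduleP.
  exists (Submodule U0 UP) => //; split=> [d Ud|p Gp]; last by right.
  by have [S [fS Sd _ _]] := covU _ _ Ud Ud; apply: fS.
have [M ME [fM GM]] := TX.
have totM v : exists d, M (v, d).
  have [M' fM' [MM' [d hd]]] := baer_graph_extend v fM.
  exists d; apply: contrapT => nMd; apply: (maxX (in_submodule M')).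
    split=> [|/(_ _ hd) Xd]; last by apply: nMd; rewrite -ME; left.
    by move=> p Xp; apply: MM'; rewrite -ME; left.
  exists M'; last by split=> // p /GM/MM'.
  by apply/seteqP; split=> p; [case=> // /GM/MM' | left].
have uniqM v d e : M (v, d) -> M (v, e) -> d = e.
  move=> hd he; apply/eqP; rewrite -subr_eq0; apply/eqP/fM.
  by have := submoduleB hd he; congr (in_submodule _ (_, _)); rewrite /= subrr.
have [h hP] := choice totM.
have hL : linear h.
  move=> a u v; apply: uniqM (hP _) _.
  exact: (submoduleP a (hP u) (hP v)).
pose hM := GRing.isLinear.Build R V D _ h hL.
by exists (HB.pack h hM : {linear V -> D}) => v d /GM; apply: uniqM (hP v).
Qed.

End Baer.

Lemma baer_injective (R : pzRingType) (D : lmodType R) :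
  baer_module D -> injective_module D.
Proof.
move=> baerD A B i inj_i f.
pose P (p : B * D) := exists a, p = (i a, f a).
have P0 : P 0 by exists 0; rewrite !linear0.
have PP a p q : P p -> P q -> P (a *: p + q).
  by move=> [u ->] [v ->]; exists (a *: u + v); rewrite !linearP.
have [|g gP] := @baer_graph _ _ _ baerD (Submodule P0 PP).
  move=> d [a [/esym ia0 ->]].
  have -> : a = 0 by apply: inj_i; rewrite ia0 linear0.
  by rewrite linear0.
by exists g => a; apply: gP; exists a.
Qed.

(** * The group Q/Z and characters of abelian groups *)

Definition rat_integers : submodule (zmodule rat).
Proof.
exists (fun q => (q : rat) \is a Num.int : Prop); first exact: rpred0.
by move=> a u v hu hv; apply: rpredD hv; rewrite /GRing.scale /= rpredMz.
Defined.

Definition QZ : lmodType int := quotient_module rat_integers.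

(** Over Z, closure under subtraction is enough to be a submodule. *)
Definition subgroup_submodule (W : lmodType int) (P : W -> Prop) :
  P 0 -> (forall u v, P u -> P v -> P (u - v)) -> submodule W.
Proof.
move=> P0 PB; exists P => // a u v Pu Pv.
have PN w : P w -> P (- w) by move=> Pw; rewrite -sub0r; apply: PB.
have PD w w' : P w -> P w' -> P (w + w').
  by move=> Pw Pw'; rewrite -[w']opprK; apply/PB/PN.
have Pn (n : nat) : P (n%:Z *: u).
  by elim: n => [|n IHn]; rewrite ?scale0r // intS scalerDl scale1r; apply: PD.
apply: PD => //; case: a => n; first exact: Pn.
by rewrite NegzE scaleNr; apply/PN/Pn.
Defined.

Lemma int_submodule_principal (J : submodule int^o) :
  exists m : nat, forall n : int, J n <-> (m %| n)%Z.
Proof.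
have absJ n : J n -> J `|n|%N.
  move=> Jn; case: (intP n) Jn => // k.
  by rewrite abszN => /submoduleN; rewrite opprK.
have [[k [k0 Jk]]|noJ] := pselect (exists k : nat, (0 < k)%N /\ J k).
  have ex : exists k : nat, (0 < k)%N && `[< J k >].
    by exists k; rewrite k0; apply/asboolP.
  case: (ex_minnP ex) => m /andP[m0 /asboolP Jm] minm; exists m => n.
  split=> [Jn|/dvdzP[q ->]]; last exact: (submoduleZ q Jm).
  apply/dvdz_mod0P.
  have Jr : J (n %% m)%Z.
    by rewrite /modz -mulNr addrC; exact: submoduleP Jm Jn.
  have r0 : (0 <= n %% m)%Z by rewrite modz_ge0 // eqz_nat -lt0n.
  have rm : ((n %% m)%Z < m)%R by rewrite ltz_pmod.
  move: Jr r0 rm; case: (n %% m)%Z => // r Jr _; rewrite ltz_nat => rm.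
  case: r Jr rm => // r Jr rm.
  by have := minm r.+1; rewrite ltn0Sn leqNgt rm => /(_ (introT (asboolP _) Jr)).
exists 0%N => n; rewrite dvd0z; split=> [Jn|/eqP->]; last exact: submodule0.
apply: contrapT => n0; apply: noJ; exists `|n|%N; split; last exact: absJ.
by rewrite absz_gt0; apply/negP.
Qed.

Lemma QZ_divisible (m : nat) (d : QZ) :
  (0 < m)%N -> exists e : QZ, d = m%:Z *: e.
Proof.
move=> m0; have [q <-] := quotient_proj_surj d.
exists (quotient_proj rat_integers (q / m%:R : rat)).
rewrite -linearZ; congr (quotient_proj _ _).
by rewrite /GRing.scale /= -mulrzl pmulrn mulrCA divff ?mulr1 // pnatr_eq0 -lt0n.
Qed.

(** The class of 1/m; for m = 0 any nonzero class serves, and 1/2 is taken. *)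
Lemma QZ_order (m : nat) : exists2 d : QZ,
  (forall n : int, (m %| n)%Z -> n *: d = 0) & (m != 1)%N -> d <> 0.
Proof.
pose k := if m == 0%N then 2%N else m.
have kQ0 : k%:R != 0 :> rat by rewrite pnatr_eq0 /k; case: ifP => // ->.
exists (quotient_proj rat_integers (k%:R^-1 : rat)).
  move=> n mn; rewrite -linearZ; apply/quotient_proj0 => /=.
  rewrite /GRing.scale /= -mulrzl.
  have /dvdzP[q ->] : (k %| n)%Z.
    by move: mn; rewrite /k; case: eqP => // ->; rewrite dvd0z => /eqP->.
  by rewrite intrM -mulrA pmulrn divff ?mulr1.
move=> m1 /quotient_proj0 /= /intrP[z zE].
have : z * k = 1 by apply: (@intr_inj rat); rewrite intrM -zE pmulrn mulVf.
move/(congr1 absz); rewrite abszM absz_nat => /eqP; rewrite muln_eq1 => /andP[_].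
by move: m1; rewrite /k; case: ifP => // _ /negP.
Qed.

(** The ideals of Z are principal, so divisibility suffices. *)
Lemma baer_QZ : baer_module QZ.
Proof.
move=> J fJ.
have [I IP] : exists I : submodule int^o, forall n, I n <-> exists d, J (n, d).
  have P0 : exists d, J (0, d) by exists 0; apply: submodule0.
  have PB (a : int) (u v : int^o) :
      (exists d, J (u, d)) -> (exists d, J (v, d)) ->
      exists d, J (a *: u + v, d).
    by move=> [d hd] [e he]; exists (a *: d + e); apply: (submoduleP a hd he).
  by exists (Submodule P0 PB).
have [m mP] := int_submodule_principal I.
have [d Jmd] : exists d, J (m%:Z, d) by apply/IP/mP.
have uniqJ n e e' : J (n, e) -> J (n, e') -> e = e'.
  move=> he he'; apply/eqP; rewrite -subr_eq0; apply/eqP/fJ.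
  by have := submoduleB he he'; congr (in_submodule _ (_, _)); rewrite /= subrr.
have [e de] : exists e : QZ, d = m%:Z *: e.
  case: (posnP m) Jmd => [->|m0] Jmd; last exact: QZ_divisible.
  by exists 0; rewrite scaler0; apply: fJ.
exists e => s f Jsf; have /mP/dvdzP[q sE] : I s by apply/IP; exists f.
apply: uniqJ Jsf _; rewrite sE -scalerA -de.
exact: (submoduleZ q Jmd).
Qed.

(** A type of additive maps of its own, so that the two module structures
below can be attached to aliases of it. *)
Record character (V : zmodType) := Character {
  char_fun :> V -> QZ;
  char_funB : forall u v, char_fun (u - v) = char_fun u - char_fun v }.

HB.instance Definition _ (V : zmodType) (c : character V) :=
  GRing.isZmodMorphism.Build V QZ (char_fun c) (@char_funB V c).

Section CharacterGroup.
Variable V : zmodType.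

Lemma characterP (c d : character V) : (forall v, c v = d v) -> c = d.
Proof.
case: c d => [c cB] [d dB] /= cd; have ecd : c = d by apply/funext.
by subst d; congr Character; apply: Prop_irrelevance.
Qed.

HB.instance Definition _ := gen_eqMixin (character V).
HB.instance Definition _ := gen_choiceMixin (character V).

Definition char_zero : character V :=
  @Character V (fun=> 0) (fun _ _ => esym (subrr 0)).

Definition char_opp (c : character V) : character V.
Proof. by exists (fun v => - c v) => u v; rewrite raddfB opprB opprK addrC. Defined.

Definition char_add (c d : character V) : character V.
Proof.
by exists (fun v => c v + d v) => u v; rewrite !raddfB /= opprD addrACA.
Defined.

Fact char_addA : associative char_add.
Proof. by move=> c d e; apply: characterP => v; apply: addrA. Qed.
Fact char_addC : commutative char_add.
Proof. by move=> c d; apply: characterP => v; apply: addrC. Qed.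
Fact char_add0 : left_id char_zero char_add.
Proof. by move=> c; apply: characterP => v; apply: add0r. Qed.
Fact char_addN : left_inverse char_zero char_opp char_add.
Proof. by move=> c; apply: characterP => v; apply: addNr. Qed.

HB.instance Definition _ :=
  GRing.isZmodule.Build (character V) char_addA char_addC char_add0 char_addN.

Lemma char_addE (c d : character V) v : (c + d) v = c v + d v. Proof. by []. Qed.

Lemma char_sumE I (r : seq I) (c : I -> character V) v :
  (\sum_(i <- r) c i) v = \sum_(i <- r) c i v.
Proof.
by elim: r => [|i r IHr]; rewrite ?big_nil ?big_cons // char_addE IHr.
Qed.

Lemma character_graph (P : V -> QZ -> Prop) :
  P 0 0 -> (forall u v d e, P u d -> P v e -> P (u - v) (d - e)) ->
  (forall d, P 0 d -> d = 0) ->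
  exists c : character V, forall v d, P v d -> c v = d.
Proof.
move=> P0 PB fP.
have [|h hP] := @baer_graph _ (zmodule V) QZ baer_QZ
  (@subgroup_submodule (zmodule V * QZ)%type (fun p => P p.1 p.2)
     P0 (fun p q hp hq => PB _ _ _ _ hp hq)).
  by move=> d; apply: fP.
have hB (u v : V) : h (u - v) = h u - h v by apply: (raddfB h).
by exists (Character hB) => v d; apply: hP.
Qed.

(** Q/Z cogenerates abelian groups: a character of the cyclic group generated
by x modulo H, nonzero at x, is extended to V. *)
Lemma character_separates (H : V -> Prop) x :
  H 0 -> (forall u v, H u -> H v -> H (u - v)) -> ~ H x ->
  exists2 c : character V, forall h, H h -> c h = 0 & c x <> 0.
Proof.
move=> H0 HB Hx.
pose HS := @subgroup_submodule (zmodule V) H H0 HB.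
pose J n := H (x *~ n).
have J0 : J 0 by rewrite /J mulr0z.
have JB m n : J m -> J n -> J (m - n) by rewrite /J mulrzBr; apply: HB.
have [m mP] := int_submodule_principal (@subgroup_submodule int^o J J0 JB).
have [d d0 dN0] := QZ_order m.
pose P v e := exists2 n : int, H (v - x *~ n) & e = n *: d.
have [|||c cP] := @character_graph P.
- by exists 0; rewrite ?mulr0z ?subr0 ?scale0r.
- move=> u v e f [n hn ->] [k hk ->]; exists (n - k); last by rewrite scalerBl.
  have -> : u - v - x *~ (n - k) = (u - x *~ n) - (v - x *~ k).
    by rewrite mulrzBr !opprB addrACA [RHS]addrACA [- v - _]addrC.
  exact: (HB _ _ hn hk).
- move=> e [n hn ->]; apply: d0; apply/mP; rewrite /= /J.
  by have := HB _ _ H0 hn; rewrite !sub0r opprK.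
exists c => [h hh|].
  by apply: cP; exists 0; rewrite ?scale0r ?mulr0z ?subr0.
have -> : c x = d by apply: cP; exists 1; rewrite ?scale1r ?subrr.
apply: dN0; apply/eqP => m1; apply: Hx.
by have := (mP 1).2; rewrite m1 /= /J mulr1z; apply.
Qed.

End CharacterGroup.

Lemma character_extend (U V : zmodType) (i : {additive U -> V})
    (c : character U) :
  injective i -> exists d : character V, forall u, d (i u) = c u.
Proof.
move=> inj_i; pose P v e := exists2 u, i u = v & c u = e.
have [|||d dP] := @character_graph V P.
- by exists 0; rewrite raddf0.
- by move=> _ _ _ _ [u <- <-] [v <- <-]; exists (u - v); rewrite raddfB.
- move=> _ [u u0 <-]; have -> : u = 0 by apply: inj_i; rewrite u0 raddf0.
  by rewrite raddf0.
by exists d => u; apply: dP; exists u.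
Qed.

(** * Character modules *)

Section LeftCharacterModule.
Variables (R : pzRingType) (F : lmodType R^c).

Definition lchar : Type := character F.

HB.instance Definition _ := GRing.Zmodule.on lchar.

Definition lchar_scale (a : R) (c : lchar) : lchar.
Proof.
by exists (fun x => c ((a : R^c) *: x)) => u v; rewrite scalerBr raddfB.
Defined.

Fact lchar_scaleA a b c :
  lchar_scale a (lchar_scale b c) = lchar_scale (a * b) c.
Proof. by apply: characterP => x /=; rewrite scalerA. Qed.
Fact lchar_scale1 : left_id 1 lchar_scale.
Proof. by move=> c; apply: characterP => x; rewrite /= scale1r. Qed.
Fact lchar_scaleDr : right_distributive lchar_scale +%R.
Proof. by move=> a c d; apply: characterP. Qed.
Fact lchar_scaleDl c : {morph lchar_scale^~ c : a b / a + b}.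
Proof.
by move=> a b; apply: characterP => x; rewrite char_addE /= scalerDl raddfD.
Qed.

HB.instance Definition _ := GRing.Zmodule_isLmodule.Build R lchar
  lchar_scaleA lchar_scale1 lchar_scaleDr lchar_scaleDl.

Lemma lchar_scaleE a (c : lchar) x : (a *: c : lchar) x = c ((a : R^c) *: x).
Proof. by []. Qed.

End LeftCharacterModule.

Section RightCharacterModule.
Variables (R : pzRingType) (N : lmodType R).

Definition rchar : Type := character N.

HB.instance Definition _ := GRing.Zmodule.on rchar.

Definition rchar_scale (a : R^c) (c : rchar) : rchar.
Proof.
by exists (fun x => c ((a : R) *: x)) => u v; rewrite scalerBr raddfB.
Defined.

Fact rchar_scaleA a b c :
  rchar_scale a (rchar_scale b c) = rchar_scale (a * b) c.
Proof. by apply: characterP => x /=; rewrite scalerA. Qed.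
Fact rchar_scale1 : left_id 1 rchar_scale.
Proof. by move=> c; apply: characterP => x; rewrite /= scale1r. Qed.
Fact rchar_scaleDr : right_distributive rchar_scale +%R.
Proof. by move=> a c d; apply: characterP. Qed.
Fact rchar_scaleDl c : {morph rchar_scale^~ c : a b / a + b}.
Proof.
by move=> a b; apply: characterP => x; rewrite char_addE /= scalerDl raddfD.
Qed.

HB.instance Definition _ := GRing.Zmodule_isLmodule.Build R^c rchar
  rchar_scaleA rchar_scale1 rchar_scaleDr rchar_scaleDl.

End RightCharacterModule.

(** * Tensor products and character modules *)

Section TensorSums.
Variables (R : pzRingType) (M : lmodType R^c) (N : lmodType R).

Lemma tens0l n : tens 0 n = 0 :> tensor M N.
Proof. by apply: (addrI (tens 0 n)); rewrite -tensDl !addr0. Qed.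

Lemma tens0r m : tens m 0 = 0 :> tensor M N.
Proof. by apply: (addrI (tens m 0)); rewrite -tensDr !addr0. Qed.

Lemma tens_suml I (r : seq I) (F : I -> M) n :
  tens (\sum_(i <- r) F i) n = \sum_(i <- r) tens (F i) n :> tensor M N.
Proof.
by elim: r => [|i r IHr]; rewrite ?big_nil ?tens0l // !big_cons tensDl IHr.
Qed.

Lemma tens_sumr I (r : seq I) (F : I -> N) m :
  tens m (\sum_(i <- r) F i) = \sum_(i <- r) tens m (F i) :> tensor M N.
Proof.
by elim: r => [|i r IHr]; rewrite ?big_nil ?tens0r // !big_cons tensDr IHr.
Qed.

End TensorSums.

Section TensorCharacters.
Variables (R : pzRingType) (M : lmodType R^c) (N : lmodType R).

Lemma balanced_lchar_eval (g : {linear N -> lchar M}) :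
  balanced (fun (m : M) (n : N) => (g n : character M) m).
Proof.
split=> [m m' n|m n n'|m a n]; first exact: raddfD.
  by rewrite raddfD.
by rewrite linearZ.
Qed.

(** One direction of the adjunction between the characters of M (x) N and the
linear maps from N to M^+; the other one is [balanced_character] applied to
[balanced_lchar_eval]. *)
Definition tensor_char (c : character (tensor M N)) : N -> lchar M.
Proof.
move=> n; exists (fun m => c (tens m n)) => m m'.
have tensNl : tens (- m') n = - tens m' n.
  by apply: (addrI (tens m' n)); rewrite -tensDl !subrr tens0l.
by rewrite tensDl tensNl raddfB.
Defined.

Fact tensor_char_linear c : linear (tensor_char c).
Proof.
move=> a n n'; apply: characterP => m.
by rewrite char_addE lchar_scaleE /= tensDr raddfD tensZ.
Qed.

HB.instance Definition _ c :=
  GRing.isLinear.Build R N (lchar M) _ (tensor_char c) (tensor_char_linear c).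

Lemma balanced_character (b : M -> N -> QZ) : balanced b ->
  exists c : character (tensor M N), forall m n, c (tens m n) = b m n.
Proof.
move=> hb; exists (Character (tensor_lift_additive hb)) => m n /=.
exact: tensor_liftE.
Qed.

(** Every tensor is an integral combination of pure ones. *)
Lemma tensor_eq_add (G : zmodType) (f g : {additive tensor M N -> G}) :
  (forall m n, f (tens m n) = g (tens m n)) -> f =1 g.
Proof.
move=> fg t; rewrite -[t]reprK; move: (repr t) => {t}.
pose h x := f (\pi_(tensor M N) x) - g (\pi_(tensor M N) x).
have hB : zmod_morphism h.
  by move=> x y; rewrite /h !pi_tensorB !raddfB /= addrACA.
pose H : {additive _ -> G} := HB.pack h (GRing.isZmodMorphism.Build _ _ h hB).
suff H0 x : H x = 0.
  by move=> x; apply/eqP; rewrite -subr_eq0; apply/eqP; exact: (H0 x).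
elim/freeg_ind_dom0: x => [|k p D _ _ IH]; first exact: raddf0.
rewrite raddfD IH addr0 -[k]intz -freegU_mulz raddfMz.
by case: p => m n; rewrite /= /h fg subrr mul0rz.
Qed.

End TensorCharacters.

Section TensorMaps.
Variables (R : pzRingType) (M M' : lmodType R^c) (N N' : lmodType R).
Variables (f : {linear M -> M'}) (g : {linear N -> N'}).

Fact tensor_map_balanced : balanced (fun m n => tens (f m) (g n)).
Proof.
split=> *; first by rewrite linearD tensDl.
  by rewrite linearD tensDr.
by rewrite !linearZ tensZ.
Qed.

Lemma tensor_mapB : {morph tensor_map f g : x y / x - y}.
Proof. exact/tensor_lift_additive/tensor_map_balanced. Qed.

HB.instance Definition _ := GRing.isZmodMorphism.Build _ _ _ tensor_mapB.

End TensorMaps.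

(** A map A -> F^+ is a character of F (x) A, and the latter extends along the
injection F (x) A -> F (x) B that purity provides. *)
Lemma lchar_pure_injective (R : pzRingType) (F : lmodType R^c) :
  pure_injective (lchar F).
Proof.
move=> A B C i p [_ /(_ F)[inj_i _ _]] f.
have [c cE] := balanced_character (balanced_lchar_eval f).
have [d dE] := character_extend (i := tensor_map (@idfun F) i) c inj_i.
exists (tensor_char d) => a; apply: characterP => x /=.
by rewrite -cE -dE /= (tensor_mapE (@idfun F) i).
Qed.

(** A nonzero tensor t of F (x) A is detected by a character, that is by a map
A -> F^+.  Extending this map to B gives a character of F (x) B that does not
vanish at the image of t. *)
Lemma lchar_injective_flat (R : pzRingType) (F : lmodType R^c) :
  injective_module (lchar F) -> right_flat F.
Proof.
move=> injF A B f inj_f.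
suff ker0 t : tensor_map (@idfun F) f t = 0 -> t = 0.
  move=> s t st; apply/eqP; rewrite -subr_eq0; apply/eqP/ker0.
  by rewrite (tensor_mapB (@idfun F) f) st subrr.
move=> ft0; apply: contrapT => t0.
have [||c c0 ct] := @character_separates _ (fun s => s = 0) t _ _ t0.
- by [].
- by move=> u v -> ->; rewrite subr0.
have [g gE] := injF _ _ f inj_f (tensor_char c).
have [d dE] := balanced_character (balanced_lchar_eval g).
apply: ct; rewrite -(raddf0 d) -ft0; apply/esym.
apply: (@tensor_eq_add _ _ _ _ (d \o tensor_map (@idfun F) f) c) => m n /=.
by rewrite (tensor_mapE (@idfun F) f) dE gE.
Qed.

(** * Linear systems in absolutely pure modules *)

Section LinearCombinations.
Variables (R : pzRingType) (N : lmodType R) (k : nat) (v : 'I_k -> N).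

Definition lincomb (r : 'rV[R]_k) : N := \sum_i r 0 i *: v i.

Fact lincomb_linear : linear lincomb.
Proof.
move=> a r s; rewrite /lincomb scaler_sumr -big_split; apply: eq_bigr => i _ /=.
by rewrite !mxE scalerDl scalerA.
Qed.

HB.instance Definition _ :=
  GRing.isLinear.Build R 'rV[R]_k N _ lincomb lincomb_linear.

Lemma lincomb_delta i : lincomb (delta_mx 0 i) = v i.
Proof.
rewrite /lincomb (bigD1 i) //= big1 ?addr0 => [|j /negbTE ji].
  by rewrite mxE !eqxx scale1r.
by rewrite mxE ji andbF scale0r.
Qed.

End LinearCombinations.

Lemma lincomb_col (R : pzRingType) k (b : 'cV[R]_k) (r : 'rV[R]_k) :
  lincomb (fun i => b i 0 : R^o) r = (r *m b) 0 0.
Proof. by rewrite mxE. Qed.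

Lemma linear_rV_lincomb (R : pzRingType) (N : lmodType R) k
  (f : {linear 'rV[R]_k -> N}) r : f r = lincomb (fun i => f (delta_mx 0 i)) r.
Proof.
rewrite [r in LHS]row_sum_delta linear_sum; apply: eq_bigr => i _.
by rewrite linearZ.
Qed.

(** The extension is the pushout of N and R^k over R^l, under v and A: it adds
to N a universal solution of the system, and consistency is what keeps N
embedded in it. *)
Lemma linear_system_extension (R : pzRingType) (N : lmodType R) l k
    (A : 'M[R]_(l, k)) (v : 'I_l -> N) :
  (forall r : 'rV_l, r *m A = 0 -> lincomb v r = 0) ->
  exists (B C : lmodType R) (f : {linear N -> B}) (g : {linear B -> C})
         (x : 'I_k -> B),
    short_exact f g /\ forall i, f (v i) = \sum_j A i j *: x j.
Proof.
move=> consistent.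
pose rel (r : 'rV[R]_l) : (N * 'rV[R]_k)%type := (- lincomb v r, r *m A).
have relL : linear rel.
  move=> a r s; rewrite /rel mulmxDl -scalemxAl linearP opprD -scalerN.
  by [].
pose relM : {linear _ -> _} :=
  HB.pack rel (GRing.isLinear.Build R _ _ _ rel relL).
pose B : lmodType R := quotient_module (img_submodule relM).
pose f0 (n : N) : B := quotient_proj (img_submodule relM) (n, 0).
have f0L : linear f0.
  move=> a m n; rewrite /f0 -linearP; congr (quotient_proj _ _).
  by congr (_, _); rewrite /= scaler0 addr0.
pose f : {linear N -> B} := HB.pack f0 (GRing.isLinear.Build R _ _ _ f0 f0L).
pose C : lmodType R := quotient_module (img_submodule f).
pose g : {linear B -> C} := quotient_proj (img_submodule f).
exists B, C, f, g,
  (fun j => quotient_proj (img_submodule relM) (0, delta_mx 0 j)).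
split; [split|] => [m n /= mn|b|c|i].
- apply/eqP; rewrite -subr_eq0; apply/eqP.
  have /quotient_proj_eq [r [e1 e2]] := mn.
  by move: e1; rewrite (consistent r) ?oppr0 // e2 subr0.
- exact: quotient_proj0.
- exact: quotient_proj_surj.
rewrite /= /f0; under eq_bigr do rewrite -linearZ.
rewrite -linear_sum; apply/esym/quotient_proj_eq; exists (delta_mx 0 i).
rewrite /= /rel lincomb_delta -rowE.
rewrite [X in _ = X - _](_ : _ = (0, row i A)).
  by congr (_, _); rewrite /= ?subr0 ?sub0r.
rewrite [row i A]row_sum_delta; elim/big_rec2: _ => // j p q _ ->.
by congr (_, _); rewrite /= ?scaler0 ?addr0 // mxE.
Qed.

(** Characters of a finite power are families of characters. *)
Lemma row_character (N : zmodType) l (c : character 'rV[N]_l) :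
  exists d : 'I_l -> character N, forall w, c w = \sum_i d i (w 0 i).
Proof.
pose single i (n : N) : 'rV[N]_l := \row_j (if j == i then n else 0).
have singleB i n m : single i (n - m) = single i n - single i m.
  by apply/rowP => j; rewrite !mxE; case: eqP; rewrite ?subr0.
have dB i n m : c (single i (n - m)) = c (single i n) - c (single i m).
  by rewrite singleB raddfB.
exists (fun i => Character (dB i)) => w /=; rewrite -raddf_sum; congr (c _).
apply/rowP => j; rewrite summxE (bigD1 j) //= big1 ?addr0 => [|i /negbTE ij].
  by rewrite mxE eqxx.
by rewrite mxE eq_sym ij.
Qed.

(** The tuples for which the system has a solution form a subgroup of N^l, and
the characters that vanish on it are the families c of the hypothesis. *)
Lemma system_solvable_by_characters (R : pzRingType) (N : lmodType R) l k
    (A : 'M[R]_(l, k)) (v : 'I_l -> N) :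
  (forall c : 'I_l -> character N,
     (forall j n, \sum_i c i (A i j *: n) = 0) -> \sum_i c i (v i) = 0) ->
  exists x : 'I_k -> N, forall i, v i = \sum_j A i j *: x j.
Proof.
move=> hv; apply: contrapT => nosol.
pose H (w : 'rV[N]_l) :=
  exists x : 'I_k -> N, forall i, w 0 i = \sum_j A i j *: x j.
have [|||c cH cv] := @character_separates _ H (\row_i v i).
- by exists (fun=> 0) => i; rewrite mxE big1 // => j _; rewrite scaler0.
- move=> u w [x hx] [y hy]; exists (fun j => x j - y j) => i.
  by rewrite !mxE hx hy -sumrB; apply: eq_bigr => j _; rewrite scalerBr.
- by move=> [x hx]; apply: nosol; exists x => i; rewrite -hx mxE.
have [d dE] := row_character c.
apply: cv; rewrite dE; under eq_bigr do rewrite mxE; apply: hv => j n.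
have : c (\row_i (A i j *: n)) = 0.
  apply: cH; exists (fun j' => if j' == j then n else 0) => i.
  rewrite mxE (bigD1 j) //= eqxx big1 ?addr0 // => j' /negbTE ->.
  by rewrite scaler0.
by rewrite dE; under eq_bigr do rewrite mxE.
Qed.

(** Purity of an extension with a solution x is tested on the right module N^+:
the tensor sum_i c_i (x) v_i vanishes in the extension, as it equals there
sum_j (sum_i c_i A_ij) (x) x_j, hence it vanishes in N^+ (x) N, and evaluation
gives sum_i c_i(v_i) = 0. *)
Lemma left_absolutely_pure_solvable (R : pzRingType) (N : lmodType R) l k
    (A : 'M[R]_(l, k)) (v : 'I_l -> N) :
  left_absolutely_pure N ->
  (forall r : 'rV_l, r *m A = 0 -> lincomb v r = 0) ->
  exists x : 'I_k -> N, forall i, v i = \sum_j A i j *: x j.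
Proof.
move=> pureN /linear_system_extension[B [C [f [g [x [fg xE]]]]]].
apply: system_solvable_by_characters => c cA.
have [_ /(_ (rchar N))[inj_f _ _]] := pureN _ _ _ _ fg.
have ev_bal : balanced (fun (c : rchar N) (n : N) => (c : character N) n).
  by split=> [d d' n|d n n'|d a n] //; rewrite raddfD.
have [e eE] := balanced_character ev_bal.
under eq_bigr do rewrite -eE.
rewrite -raddf_sum (_ : \sum_i _ = 0) ?raddf0 //; apply: inj_f.
rewrite (raddf0 (tensor_map (@idfun (rchar N)) f)) raddf_sum.
under eq_bigr => i _ do
  rewrite /= (tensor_mapE (@idfun (rchar N)) f) xE tens_sumr.
rewrite exchange_big big1 // => j _ /=.
under eq_bigr do rewrite -tensZ.
rewrite -tens_suml (_ : \sum_i _ = 0) ?tens0l //.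
by apply: characterP => n; rewrite char_sumE cA.
Qed.

Lemma right_absolutely_pure_solvable (R : pzRingType) (N : lmodType R^c) l k
    (A : 'M[R^c]_(l, k)) (v : 'I_l -> N) :
  right_absolutely_pure N ->
  (forall r : 'rV_l, r *m A = 0 -> lincomb v r = 0) ->
  exists x : 'I_k -> N, forall i, v i = \sum_j A i j *: x j.
Proof.
move=> pureN /linear_system_extension[B [C [f [g [x [fg xE]]]]]].
apply: system_solvable_by_characters => c cA.
have [_ /(_ (lchar N))[inj_f _ _]] := pureN _ _ _ _ fg.
have ev_bal : balanced (fun (n : N) (c : lchar N) => (c : character N) n).
  by split=> [n n' d|n d d'|n a d] //; rewrite raddfD.
have [e eE] := balanced_character ev_bal.
under eq_bigr do rewrite -eE.
rewrite -raddf_sum (_ : \sum_i _ = 0) ?raddf0 //; apply: inj_f.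
rewrite (raddf0 (tensor_map f (@idfun (lchar N)))) raddf_sum.
under eq_bigr => i _ do
  rewrite /= (tensor_mapE f (@idfun (lchar N))) xE tens_suml.
rewrite exchange_big big1 // => j _ /=.
under eq_bigr do rewrite tensZ.
rewrite -tens_sumr (_ : \sum_i _ = 0) ?tens0r //.
by apply: characterP => n; rewrite char_sumE cA.
Qed.

(** The left ideal generated by v, as a module given with its generators. *)
Lemma generated_left_ideal (R : pzRingType) k (v : 'I_k -> R^o) :
  exists (I : lmodType R) (i : {linear I -> R^o}) (x : 'I_k -> I),
    [/\ injective i, forall j, i (x j) = v j
      & forall y, exists r, lincomb x r = y].
Proof.
pose K := ker_submodule (lincomb v).
have [i inj_i iE] := quotient_kernel_embeds (lincomb v).
exists (quotient_module K), i, (fun j => quotient_proj K (delta_mx 0 j)).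
split=> // [j|y]; first by rewrite iE /= lincomb_delta.
have [r <-] := quotient_proj_surj y; exists r.
by rewrite [RHS]linear_rV_lincomb.
Qed.

(** * Coherence and semihereditary rings *)

Lemma linear_rV_lift (R : pzRingType) k (M N : lmodType R)
    (f : {linear 'rV[R]_k -> N}) (p : {linear M -> N}) :
  (forall n, exists m, p m = n) ->
  exists g : {linear 'rV[R]_k -> M}, forall r, p (g r) = f r.
Proof.
move=> /choice[s sK]; exists (lincomb (fun i => s (f (delta_mx 0 i)))) => r.
rewrite [RHS]linear_rV_lincomb linear_sum; apply: eq_bigr => i _.
by rewrite linearZ /= sK.
Qed.

(** Coherence gives a finite presentation of the left ideal, but on unrelated
generators.  As in Schanuel's lemma, with U and W the matrices that
express each set of generators in terms of the other, the relations of b are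
generated by those transported along W and by the rows of 1 - U W. *)
Lemma coherent_syzygies (R : pzRingType) k (b : 'cV[R]_k) : left_coherent R ->
  exists (l : nat) (C : 'M[R]_(l, k)), C *m b = 0 /\
    forall r : 'rV_k, r *m b = 0 -> exists u, r = u *m C.
Proof.
move=> cohR.
have [I [i [x [inj_i ix gen_x]]]] :=
  generated_left_ideal (fun j => b j 0 : R^o).
have fgI : finitely_generated I.
  by exists k, x => y; have [r <-] := gen_x y; exists (fun j => r 0 j).
have ixE r : i (lincomb x r) = (r *m b) 0 0.
  rewrite -lincomb_col linear_sum; apply: eq_bigr => j _.
  by rewrite linearZ /= ix.
have x0E r : lincomb x r = 0 <-> r *m b = 0.
  split=> [x0|r0]; last by apply: inj_i; rewrite ixE r0 linear0 mxE.
  by apply/rowP => j; rewrite ord1 -ixE x0 linear0 mxE.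
have [n [k' [q [p [qp p_surj]]]]] := cohR I i inj_i fgI.
(* Here U : R^k -> R^n and W : R^n -> R^k commute with the maps onto I. *)
have [U UE] := linear_rV_lift (lincomb x) p_surj.
have [W WE] := linear_rV_lift p gen_x.
pose C := col_mx (lin1_mx (W \o q)) (1%:M - lin1_mx (W \o U)).
exists (k' + k)%N, C; split=> [|r rb].
  apply/row_matrixP => t; rewrite row_mul row0; apply/x0E.
  rewrite rowE; move: (delta_mx 0 t) => r; rewrite -[r]hsubmxK mul_row_col.
  rewrite mulmxBr mulmx1 !mul_rV_lin1 /= linearD linearB /= !WE UE subrr addr0.
  by apply/qp; exists (lsubmx r).
have /qp[u uE] : p (U r) = 0 by rewrite UE; apply/x0E.
exists (row_mx u r); rewrite mul_row_col mulmxBr mulmx1 !mul_rV_lin1 /= uE.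
by rewrite addrC subrK.
Qed.

(** Equational form of the vanishing of Tor_2(R/I, R/J) for all finitely
generated right ideals I and left ideals J. *)
Definition flat_ideals (R : pzRingType) :=
  forall k (a : 'rV[R]_k) (b : 'cV[R]_k),
  a *m b = 0 -> exists C : 'M[R]_k, a *m C = 0 /\ C *m b = b.

(** If C is a witness for R, then the transpose of 1 - C is one for the opposite
ring. *)
Lemma flat_ideals_op (R : pzRingType) : flat_ideals R -> flat_ideals R^c.
Proof.
move=> flatR k a b ab0.
have ba0 : (b^T : 'rV[R]_k) *m (a^T : 'cV[R]_k) = 0.
  by apply: (@trmx_inj R); rewrite trmx0 trmx_mul_rev !trmxK.
have [C [bC Ca]] := flatR _ _ _ ba0; exists (1%:M - C^T); split.
  rewrite mulmxBr mulmx1; apply/eqP; rewrite subr_eq0; apply/eqP.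
  by apply: (@trmx_inj R); rewrite -[LHS]Ca (trmx_mul_rev (R := R^c)) trmxK.
rewrite mulmxBl mul1mx (_ : _ *m b = 0) ?subr0 //.
by apply: (@trmx_inj R); rewrite trmx0 (trmx_mul_rev (R := R^c)) trmxK.
Qed.

(** By induction on the rows of A: if C annihilates the lower rows, apply the
condition to the first row times C, and multiply the two matrices. *)
Lemma flat_ideals_mx (R : pzRingType) k l (A : 'M[R]_(l, k)) (b : 'cV[R]_k) :
  flat_ideals R -> A *m b = 0 -> exists C : 'M[R]_k, A *m C = 0 /\ C *m b = b.
Proof.
move=> flatR; elim: l A => [|l IHl] A Ab.
  by exists 1%:M; rewrite flatmx0 mul1mx; split=> //; apply/flatmx0.
pose u := usubmx (A : 'M_(1 + l, k)); pose d := dsubmx (A : 'M_(1 + l, k)).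
have AE : A = col_mx u d :> 'M_(1 + l, k) by rewrite vsubmxK.
have [ub db] : u *m b = 0 /\ d *m b = 0.
  by apply: eq_col_mx; rewrite -mul_col_mx -AE Ab col_mx0.
have [C [dC Cb]] := IHl _ db.
have [|D [uD Db]] := flatR _ (u *m C) b; first by rewrite -mulmxA Cb.
exists (C *m D); rewrite -[_ *m _ *m b]mulmxA Db Cb; split=> //.
have : col_mx u d *m (C *m D) = 0.
  by rewrite mul_col_mx !mulmxA uD dC mul0mx col_mx0.
by rewrite -AE.
Qed.

(** If the rows of C generate the relations of b, then a matrix E with C E = 0
and E b = b makes I a direct summand of a free module. *)
Lemma flat_ideals_semihereditary (R : pzRingType) :
  left_coherent R -> flat_ideals R -> left_semihereditary R.
Proof.
move=> cohR flatR I i inj_i [k [x gen_x]] A B p p_surj f.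
pose b : 'cV[R]_k := \col_j i (x j).
have ixE r : i (lincomb x r) = (r *m b) 0 0.
  rewrite -lincomb_col linear_sum; apply: eq_bigr => j _.
  by rewrite linearZ /= mxE.
have [l [C [Cb Csyz]]] := coherent_syzygies b cohR.
have [E [CE Eb]] := flat_ideals_mx flatR Cb.
have [h hE] := linear_rV_lift (f \o lincomb x) p_surj.
have [||g gE] := @linear_factor _ _ _ _ (lincomb x) (h \o mulmxr E).
- move=> y; have [r ->] := gen_x y; exists (\row_j r j).
  by apply: eq_bigr => j _; rewrite mxE.
- move=> r xr0 /=; have [|u ->] := Csyz r.
    by apply/rowP => j; rewrite ord1 -ixE xr0 linear0 mxE.
  by rewrite -mulmxA CE mulmx0 linear0.
exists g => y; have [r ->] := gen_x y.
have -> : \sum_j r j *: x j = lincomb x (\row_j r j).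
  by apply: eq_bigr => j _; rewrite mxE.
rewrite gE /= hE /=; congr (f _); apply: inj_i.
by rewrite !ixE -mulmxA Eb.
Qed.

(** * Character modules of right ideals *)

(** Let K be the module of relations of b.  If the row x of generators is in
F K, a witness results.  Otherwise a character of F^k vanishing on F K, but not
at x, gives a map from R^k / K, the left ideal generated by b, to F^+.
Injectivity of F^+ extends it to R, so it is given by some psi in F^+, and its
value at x is psi(x b) = psi(0) = 0, a contradiction. *)
Lemma flat_ideals_witness (R : pzRingType) k (a : 'rV[R]_k) (b : 'cV[R]_k)
    (F : lmodType R^c) (i : {linear F -> (R^c)^o}) (x : 'I_k -> F) :
  injective i -> (forall j, i (x j) = a 0 j) ->
  (forall y, exists r, lincomb x r = y) ->
  injective_module (lchar F) -> a *m b = 0 ->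
  exists C : 'M[R]_k, a *m C = 0 /\ C *m b = b.
Proof.
move=> inj_i ix gen_x injF ab0.
(* The rows over F in F K, the rows of D being the relations in K. *)
pose H (w : 'rV[F]_k) := exists2 D : 'M[R]_k, D *m b = 0 &
  forall j, w 0 j = \sum_t (D t j : R^c) *: x t.
have [[D Db xD]|nHx] := pselect (H (\row_j x j)).
  exists (1%:M - D); rewrite mulmxBr mulmxBl mulmx1 mul1mx Db subr0; split=> //.
  apply/eqP; rewrite subr_eq0; apply/eqP/rowP => j.
  have := congr1 i (xD j); rewrite !mxE ix linear_sum => ->.
  by apply: eq_bigr => t _; rewrite linearZ /= ix.
have [||c cH cx] := character_separates _ _ nHx.
- exists 0 => [|j]; rewrite ?mul0mx // mxE big1 // => t _.
  by rewrite mxE scale0r.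
- move=> u w [D Db uD] [E Eb wE]; exists (D - E) => [|j].
    by rewrite mulmxBl Db Eb subr0.
  rewrite !mxE uD wE -sumrB; apply: eq_bigr => t _.
  by rewrite !mxE scalerBl.
case: cx; have [d dE] := row_character c.
have [I [h [z [inj_h hz gen_z]]]] :=
  generated_left_ideal (fun j => b j 0 : R^o).
have [r zr0|f fE] := @linear_factor _ _ _ _
    (lincomb z) (lincomb (d : 'I_k -> lchar F)) gen_z.
  have rb : r *m b = 0.
    apply/rowP => j; rewrite ord1 -lincomb_col mxE.
    have := congr1 h zr0; rewrite linear0 linear_sum => <-.
    by apply: eq_bigr => t _; rewrite linearZ /= hz.
  apply: characterP => y; have [u <-] := gen_x y.
  rewrite char_sumE -[RHS](cH (\row_j ((r 0 j : R^c) *: lincomb x u))).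
    by rewrite dE; apply: eq_bigr => j _; rewrite mxE.
  exists ((u : 'rV[R]_k)^T *m r) => [|j]; first by rewrite -mulmxA rb mulmx0.
  rewrite mxE /lincomb scaler_sumr; apply: eq_bigr => t _.
  by rewrite scalerA mxE big_ord1 mxE.
have [g gE] := injF _ _ h inj_h f.
have dg j : d j = b j 0 *: (g 1 : lchar F).
  have := gE (z j); rewrite hz -{1}[z j]lincomb_delta fE /= lincomb_delta => <-.
  by rewrite -linearZ; congr (g _); rewrite /GRing.scale /= mulr1.
rewrite dE.
have -> : \sum_j d j ((\row_j x j) 0 j) =
    (g 1 : lchar F) (\sum_j (b j 0 : R^c) *: x j).
  by rewrite raddf_sum; apply: eq_bigr => j _; rewrite mxE dg.
rewrite (_ : \sum_j _ = 0) ?raddf0 //; apply: inj_i; rewrite linear0 linear_sum.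
transitivity ((a *m b) 0 0); last by rewrite ab0 mxE.
by rewrite mxE; apply: eq_bigr => j _; rewrite linearZ /= ix.
Qed.

(** A map R -> F^+ is given by its value at 1, a character of F.  It extends to
a character of R, then along R -> K to a character d of K, and then
k |-> (y |-> d(y k)) extends the given map. *)
Lemma lchar_subinjective_ring (R : pzRingType) (F : lmodType R^c)
    (i : {linear F -> (R^c)^o}) :
  injective i -> subinjective (lchar F) (R^o : lmodType R).
Proof.
move=> inj_i K j inj_j f.
have [c cE] := character_extend (i := i) (f 1 : lchar F) inj_i.
have cB (r s : R^o) : c (r - s : R) = c (r : R) - c (s : R).
  exact: (raddfB c).
have [d dE] := character_extend (i := j) (Character cB) inj_j.
have gB k y y' :
    d ((i (y - y') : R) *: k) = d ((i y : R) *: k) - d ((i y' : R) *: k).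
  by rewrite -raddfB linearB scalerBl.
pose g k : lchar F := Character (gB k).
have gL : linear g.
  move=> a k k'; apply: characterP => y.
  rewrite char_addE lchar_scaleE /= -raddfD.
  by rewrite scalerDr scalerA linearZ.
exists (HB.pack g (GRing.isLinear.Build R K (lchar F) _ g gL)
        : {linear K -> lchar F}).
move=> r; apply: characterP => y /=.
rewrite -linearZ dE /=.
have -> : f r = (r : R) *: (f 1 : lchar F).
  by rewrite -linearZ; congr (f _); rewrite /GRing.scale /= mulr1.
rewrite lchar_scaleE -cE; congr (c _); exact: esym (linearZZ i (r : R^c) y).
Qed.

(** * Flatness of absolutely pure right modules *)

(** This is the equational criterion for flatness.  The columns v with C v = 0
are the right multiples of s, because R is absolutely pure; therefore they
are relations of n, which is the consistency of n = m C. *)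
Lemma right_absolutely_pure_relations (R : pzRingType) (N : lmodType R^c) k
    (n : 'I_k -> N) (s : 'cV[R]_k) :
  left_coherent R -> left_absolutely_pure (R^o : lmodType R) ->
  right_absolutely_pure N ->
  \sum_j (s j 0 : R^c) *: n j = 0 ->
  exists (l : nat) (C : 'M[R]_(l, k)) (m : 'I_l -> N),
    C *m s = 0 /\ forall j, n j = \sum_i (C i j : R^c) *: m i.
Proof.
move=> cohR pureR pureN ns0; have [l [C [Cs Csyz]]] := coherent_syzygies s cohR.
have [r rC|m mE] := right_absolutely_pure_solvable
    (A := (C^T : 'M[R^c]_(k, l))) (v := n) pureN.
  have [u us|y yE] := left_absolutely_pure_solvable
     (A := s) (v := fun j => r 0 j : R^o) pureR.
    have [w ->] := Csyz u us.
    have -> : (fun j => r 0 j : R^o) = (fun j => (r : 'rV[R]_k)^T j 0).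
      by apply/funext => j; rewrite mxE.
    rewrite lincomb_col -mulmxA (_ : C *m _ = 0) ?mulmx0 ?mxE //.
    by apply: (@trmx_inj R); rewrite trmx0 -rC trmx_mul_rev trmxK.
  transitivity ((y 0 : R^c) *: \sum_j (s j 0 : R^c) *: n j); last first.
    by rewrite ns0 scaler0.
  rewrite scaler_sumr; apply: eq_bigr => j _.
  by rewrite scalerA; congr (_ *: _); have := yE j; rewrite big_ord1.
exists l, C, m; split=> // j; rewrite mE.
by apply: eq_bigr => i _; rewrite mxE.
Qed.

(** For a map s |-> d_s from a left ideal to N^+, the rule n s |-> d_s(n) has to
be a well-defined character of the subgroup N J of N generated by the products;
an extension of it to N then represents the map, as Baer's criterion asks. *)
Lemma right_absolutely_pure_flat (R : pzRingType) (N : lmodType R^c) :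
  left_coherent R -> left_absolutely_pure (R^o : lmodType R) ->
  right_absolutely_pure N -> right_flat N.
Proof.
move=> cohR pureR pureN; apply/lchar_injective_flat/baer_injective => J fJ.
(* The graph of the character of N J, on sums of products. *)
pose P (n : N) (e : QZ) := exists t : seq (N * (R * lchar N)),
  [/\ forall p, p \in t -> J p.2,
      n = \sum_(p <- t) (p.2.1 : R^c) *: p.1
    & e = \sum_(p <- t) (p.2.2 : character N) p.1].
have [|||c cP] := @character_graph _ P.
- by exists [::]; split=> //; rewrite big_nil.
- move=> _ _ _ _ [t [Jt -> ->]] [t' [Jt' -> ->]].
  exists (t ++ [seq (- p.1, p.2) | p <- t']); split=> [p||].
  + by rewrite mem_cat => /orP[/Jt|/mapP[q /Jt' Jq ->]].
  + rewrite big_cat big_map /=; congr (_ + _); rewrite -sumrN.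
    by apply: eq_bigr => p _; rewrite scalerN.
  + rewrite big_cat big_map /=; congr (_ + _); rewrite -sumrN.
    by apply: eq_bigr => p _; rewrite raddfN.
- move=> e [t [Jt /esym nt ->]].
  pose p_ i := tnth (in_tuple t) i.
  pose s : 'cV[R]_(size t) := \col_i (p_ i).2.1.
  have Jp i : J (p_ i).2 by apply/Jt/mem_tnth.
  move: nt; rewrite big_tnth => nt.
  have [|l [C [m [Cs nE]]]] :=
    @right_absolutely_pure_relations _ N _ (fun i => (p_ i).1) s
      cohR pureR pureN.
    by rewrite -[RHS]nt; apply: eq_bigr => i _; rewrite mxE.
  rewrite big_tnth.
  have Cd i : lincomb (fun j => (p_ j).2.2) (row i C) = 0.
    apply: fJ.
    have -> : (0, lincomb (fun j => (p_ j).2.2) (row i C)) =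
        \sum_j C i j *: ((p_ j).2 : R^o * lchar N).
      have /matrixP/(_ i 0) := Cs; rewrite !mxE => <-.
      rewrite /lincomb; elim/big_rec3: _ => // j x y z _ <-.
      by congr (_, _); rewrite ?mxE.
    elim/big_rec: _ => [|j x _ Jx]; first exact: submodule0.
    exact: submoduleP.
  transitivity (\sum_i
    (lincomb (fun j => (p_ j).2.2) (row i C) : character N) (m i)).
    under [RHS]eq_bigr do rewrite /lincomb char_sumE.
    rewrite exchange_big; apply: eq_bigr => j _ /=.
    rewrite -/(p_ j) nE raddf_sum; apply: eq_bigr => i _.
    by rewrite mxE.
  by rewrite big1 // => i _; rewrite Cd.
exists (c : lchar N) => s d Jsd; apply: characterP => n.
rewrite lchar_scaleE; apply/esym/cP; exists [:: (n, (s, d))].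
by split=> [p||]; rewrite ?big_seq1 // inE => /eqP->.
Qed.

Theorem proposition12 (R : pzRingType) :
  ~ von_neumann_regular R ->
  left_coherent R -> right_coherent R ->
  (forall M : lmodType R, pure_injective M ->
     injective_module M \/ pi_indigent M) ->
  (left_semihereditary R /\ right_semihereditary R) \/ right_IF_ring R.
Proof.
move=> _ lcohR rcohR dichotomy.
have [flatR|nflatR] := pselect (flat_ideals R).
  left; split; first exact: flat_ideals_semihereditary.
  exact/flat_ideals_semihereditary/flat_ideals_op.
right=> N; apply: right_absolutely_pure_flat => //.
apply: contrapT => npureR; apply: nflatR => k a b ab0.
have [F [i [x [inj_i ix gen_x]]]] :=
  generated_left_ideal (fun j => a 0 j : (R^c)^o).
apply: (flat_ideals_witness inj_i ix gen_x _ ab0).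
have [//|[_ indF]] := dichotomy _ (@lchar_pure_injective _ F).
by case: npureR; apply/indF/lchar_subinjective_ring/inj_i.
Qed.
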